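(* Let $n$ be a positive integer. For every idempotent $Q\in\mathbb{C}^{n\times n}$ and every projection $P\in\mathbb{C}^{n\times n}$, we have $$\|m(Q)-Q\|_F\le \|P-Q\|_F,$$ where $m(Q)$ is the matched projection of $Q$.
   Context: An idempotent is a matrix $Q$ with $Q^2=Q$; a projection is a Hermitian idempotent ($P=P^*=P^2$). $\|\cdot\|_F$ is the Frobenius norm, $A^*$ the conjugate transpose, $A^\dag$ the Moore-Penrose inverse, and $|A|=(A^*A)^{1/2}$ the positive semi-definite square root, so $|Q^*|=(QQ^* )^{1/2}$. For an idempotent $Q\in\mathbb{C}^{n\times n}$ the matched projection is $$m(Q)=\tfrac12\big(|Q^*|+Q^*\big)\,|Q^*|^\dag\,\big(|Q^*|+I_n\big)^{-1}\big(|Q^*|+Q\big),$$ which is known to be a projection. *)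

(* Defs.v *)
From HB Require Import structures.
From mathcomp Require Import all_boot all_order all_algebra.
From mathcomp Require Import complex ring.
From mathcomp Require Import boolp classical_sets reals.

Set Implicit Arguments.
Unset Strict Implicit.
Unset Printing Implicit Defensive.

Import Order.TTheory GRing.Theory Num.Theory.

Local Open Scope ring_scope.
Local Open Scope sesquilinear_scope.

Section MatrixNotions.
Variable C : numClosedFieldType.

Definition idempotentmx n (Q : 'M[C]_n) : Prop := Q *m Q = Q.

Definition projectionmx n (P : 'M[C]_n) : Prop := P ^t* = P /\ P *m P = P.

(* The inequality is in the order of C, so it also says that the value of the
   quadratic form is real. *)
Definition psdmx n (A : 'M[C]_n) : Prop :=
  A ^t* = A /\ forall v : 'cV[C]_n, 0 <= (v ^t* *m A *m v) 0 0.

Definition is_absmx m n (A : 'M[C]_(m, n)) (B : 'M[C]_n) : Prop :=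
  psdmx B /\ B *m B = A ^t* *m A.

(* [absmx_spec] and [absmx_unique] below show that the default 0 is never
   used and that the choice is forced. *)
Definition absmx m n (A : 'M[C]_(m, n)) : 'M[C]_n :=
  xget 0 [set B | is_absmx A B]%classic.

Definition is_mpinvmx m n (A : 'M[C]_(m, n)) (X : 'M[C]_(n, m)) : Prop :=
  [/\ A *m X *m A = A, X *m A *m X = X,
      (A *m X) ^t* = A *m X & (X *m A) ^t* = X *m A].

(* Same remark, with [mpinvmx_spec] and [mpinvmx_unique]. *)
Definition mpinvmx m n (A : 'M[C]_(m, n)) : 'M[C]_(n, m) :=
  xget 0 [set X | is_mpinvmx A X]%classic.

(* The inverse is a genuine one, by [absmxD1_unit] below. *)
Definition matched_projection n (Q : 'M[C]_n) : 'M[C]_n :=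
  2^-1 *: ((absmx (Q ^t*) + Q ^t*) *m mpinvmx (absmx (Q ^t*))
           *m invmx (absmx (Q ^t*) + 1%:M) *m (absmx (Q ^t*) + Q)).

End MatrixNotions.

Definition frobenius_norm (R : rcfType) m n (A : 'M[R[i]]_(m, n)) : R :=
  Num.sqrt (\sum_(i < m) \sum_(j < n) ComplexField.Normc.normc (A i j) ^+ 2).

Section WellDefined.
Variable C : numClosedFieldType.

Lemma adjmxM m n p (A : 'M[C]_(m, n)) (B : 'M[C]_(n, p)) :
  (A *m B) ^t* = B ^t* *m A ^t*.
Proof. by rewrite trmx_mul map_mxM. Qed.

Lemma adjmxD m n (A B : 'M[C]_(m, n)) : (A + B) ^t* = A ^t* + B ^t*.
Proof. by rewrite linearD map_mxD. Qed.

Lemma adjmxB m n (A B : 'M[C]_(m, n)) : (A - B) ^t* = A ^t* - B ^t*.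
Proof. by rewrite linearB map_mxB. Qed.

Lemma adjmx1 n : (1%:M : 'M[C]_n) ^t* = 1%:M.
Proof. by rewrite trmx1 map_mx1. Qed.

Lemma adjmx_mul_diag m n (A : 'M[C]_(m, n)) (i : 'I_n) :
  (A ^t* *m A) i i = \sum_j `|A j i| ^+ 2.
Proof.
by rewrite mxE; apply: eq_bigr => j _; rewrite !mxE normCK mulrC.
Qed.

Lemma adjmx_mul_diag_ge0 m n (A : 'M[C]_(m, n)) (i : 'I_n) :
  0 <= (A ^t* *m A) i i.
Proof. by rewrite adjmx_mul_diag sumr_ge0 // => j _; rewrite exprn_ge0. Qed.

Lemma adjmx_mul_eq0 m n (A : 'M[C]_(m, n)) : A ^t* *m A = 0 -> A = 0.
Proof.
move=> A0; apply/matrixP => i j; rewrite [RHS]mxE.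
have /eqP := adjmx_mul_diag A j; rewrite A0 mxE eq_sym psumr_eq0; last first.
  by move=> k _; rewrite exprn_ge0.
by move=> /allP/(_ i (mem_index_enum _)); rewrite /= sqrf_eq0 normr_eq0 => /eqP.
Qed.

Lemma psdmx_conj_ge0 m n (B : 'M[C]_n) (S : 'M[C]_(m, n)) i :
  psdmx B -> 0 <= (S *m B *m S ^t*) i i.
Proof.
move=> [_ /(_ (col i (S ^t*)))].
suff -> : (S *m B *m S ^t*) i i
        = ((col i (S ^t*)) ^t* *m B *m col i (S ^t*)) 0 0 by [].
have -> : (col i (S ^t*)) ^t* = row i S.
  by apply/matrixP => a b; rewrite !mxE conjCK.
by rewrite -row_mul colE mulmxA -colE -row_mul !mxE.
Qed.

Lemma psdmx_conj m n (B : 'M[C]_n) (S : 'M[C]_(m, n)) :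
  psdmx B -> psdmx (S *m B *m S ^t*).
Proof.
move=> pB; have [hB _] := pB; split; first by rewrite !adjmxM trmxCK hB !mulmxA.
move=> v; have := psdmx_conj_ge0 (v ^t* *m S) 0 pB.
by rewrite adjmxM trmxCK !mulmxA.
Qed.

Lemma psdmx_diag n (d : 'rV[C]_n) : (forall i, 0 <= d 0 i) -> psdmx (diag_mx d).
Proof.
move=> d_ge0; split.
  apply/matrixP => i j; rewrite !mxE eq_sym; case: eqP => [->|_].
    by rewrite !mulr1n; apply: (CrealP _); apply: ger0_real.
  by rewrite !mulr0n conjC0.
move=> v; rewrite -mulmxA mul_diag_mx mxE sumr_ge0 // => i _.
by rewrite !mxE mulrCA mulr_ge0 // mulrC mul_conjC_ge0.
Qed.

Lemma hermitian_spectral n (A : 'M[C]_n) : A ^t* = A ->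
  exists (S : 'M[C]_n) (d : 'rV[C]_n),
    [/\ S *m S ^t* = 1%:M, S ^t* *m S = 1%:M & A = S ^t* *m diag_mx d *m S].
Proof.
move=> hA; have /orthomx_spectralP eA : A \is normalmx.
  by apply/normalmxP; rewrite hA.
have Su := spectral_unitarymx A; have SS := elimT unitarymxP Su.
exists (spectralmx A), (spectral_diag A); split => //.
  exact: mulmx1C.
by rewrite -(invmx_unitary Su).
Qed.

Lemma is_absmx_exists m n (A : 'M[C]_(m, n)) : exists B, is_absmx A B.
Proof.
have hA : (A ^t* *m A) ^t* = A ^t* *m A by rewrite adjmxM trmxCK.
have [S [d [SS1 SS2 eA]]] := hermitian_spectral hA.
have d_ge0 i : 0 <= d 0 i.
  have -> : d 0 i = ((A *m S ^t*) ^t* *m (A *m S ^t*)) i i.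
    rewrite adjmxM trmxCK -mulmxA (mulmxA _ A) eA !mulmxA SS1 mul1mx.
    by rewrite -mulmxA SS1 mulmx1 !mxE eqxx mulr1n.
  exact: adjmx_mul_diag_ge0.
pose s := map_mx sqrtC d.
exists (S ^t* *m diag_mx s *m S); split.
  rewrite -{2}[S]trmxCK; apply: psdmx_conj; apply: psdmx_diag => i.
  by rewrite mxE sqrtC_ge0.
rewrite eA !mulmxA -(mulmxA _ S (S ^t*)) SS1 mulmx1.
rewrite -(mulmxA _ (diag_mx s) (diag_mx s)).
rewrite mulmx_diag; congr (_ *m diag_mx _ *m _).
by apply/rowP => i; rewrite !mxE -expr2 sqrtCK.
Qed.

Lemma absmx_spec m n (A : 'M[C]_(m, n)) : is_absmx A (absmx A).
Proof. by have [B AB] := is_absmx_exists A; apply: (xgetPex 0); exists B. Qed.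

Lemma psdmx_sqrt_inj n (A B : 'M[C]_n) :
  psdmx A -> psdmx B -> A *m A = B *m B -> A = B.
Proof.
move=> pA pB eAB; have [hA _] := pA; have [hB _] := pB.
have hD : (A - B) ^t* = A - B by rewrite adjmxB hA hB.
have [S [d [SS1 SS2 eD]]] := hermitian_spectral hD.
pose A' := S *m A *m S ^t*; pose B' := S *m B *m S ^t*.
have eD' : A' - B' = diag_mx d.
  by rewrite /A' /B' -mulmxBl -mulmxBr eD !mulmxA SS1 mul1mx -mulmxA SS1 mulmx1.
have eAB' : A' *m A' = B' *m B'.
  rewrite /A' /B' !mulmxA -(mulmxA _ _ S) SS2 mulmx1 -(mulmxA S) eAB.
  by rewrite -[in RHS](mulmxA _ _ S) SS2 mulmx1 !mulmxA.
have A'_ge0 i : 0 <= A' i i by apply: psdmx_conj_ge0.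
have B'_ge0 i : 0 <= B' i i by apply: psdmx_conj_ge0.
have d0 : d = 0.
  move: A' B' eD' eAB' A'_ge0 B'_ge0 => A' B' eD' eAB' A'_ge0 B'_ge0.
  apply/rowP => i; rewrite [RHS]mxE.
  have : (A' - B') *m (A' + B') + (A' + B') *m (A' - B') = 0.
    rewrite !(mulmxBl, mulmxBr, mulmxDl, mulmxDr) eAB'.
    rewrite !mulmxN !mulNmx; move: (B' *m B') (A' *m B') (B' *m A') => x y z.
    by apply/matrixP => a b; rewrite !mxE; ring.
  rewrite eD' => /matrixP/(_ i i).
  rewrite mul_diag_mx mul_mx_diag !mxE => /eqP.
  rewrite [X in _ + X]mulrC -mulr2n mulrn_eq0 /= mulf_eq0.
  case/orP => [/eqP //|].
  rewrite paddr_eq0 // => /andP[/eqP A0 /eqP B0].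
  have := congr1 (fun M : 'M_n => M i i) eD'.
  by rewrite !mxE eqxx mulr1n A0 B0 subrr.
by apply/eqP; rewrite -subr_eq0 eD d0 linear0 mulmx0 mul0mx.
Qed.

Lemma absmx_unique m n (A : 'M[C]_(m, n)) B : is_absmx A B -> B = absmx A.
Proof.
move=> [pB eB]; have [pA eA] := absmx_spec A.
by apply: psdmx_sqrt_inj => //; rewrite eB eA.
Qed.

Lemma absmxD1_unit m n (A : 'M[C]_(m, n)) : absmx A + 1%:M \in unitmx.
Proof.
have [[_ pA] _] := absmx_spec A.
rewrite -unitmx_tr -row_free_unit -kermx_eq0; apply/eqP/row_matrixP => i.
rewrite row0; set u := row i _.
have u0 : u *m (absmx A + 1%:M)^T = 0 by rewrite /u -row_mul mulmx_ker row0.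
have v0 : (absmx A + 1%:M) *m u^T = 0.
  by rewrite -[LHS]trmxK trmx_mul trmxK u0 trmx0.
apply: trmx_inj; rewrite trmx0; set v := u^T in v0 *.
apply: adjmx_mul_eq0; apply/matrixP => a b; rewrite !ord1 [RHS]mxE.
have : (v ^t* *m absmx A *m v) 0 0 + (v ^t* *m v) 0 0 = 0.
  have := congr1 (fun M : 'M_1 => M 0 0) (congr1 (mulmx (v ^t*)) v0).
  by rewrite mulmxDl mul1mx mulmxDr mulmxA mulmx0 !mxE.
move/eqP; rewrite paddr_eq0 ?adjmx_mul_diag_ge0 //.
by case/andP => _ /eqP.
Qed.

Lemma row_free_gram_unit m n (A : 'M[C]_(m, n)) :
  row_free A -> A *m A ^t* \in unitmx.
Proof.
move=> Af; rewrite -row_free_unit -kermx_eq0; apply/eqP/row_matrixP => i.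
rewrite row0; set u := row i _.
have u0 : u *m (A *m A ^t*) = 0 by rewrite /u -row_mul mulmx_ker row0.
apply: (row_free_inj Af); rewrite mul0mx.
rewrite -[LHS]trmxCK; set w := (u *m A) ^t*.
suff -> : w = 0 by rewrite trmx0 map_mx0.
by apply: adjmx_mul_eq0; rewrite /w trmxCK adjmxM !mulmxA -(mulmxA u) u0 mul0mx.
Qed.

Lemma adjmx_inv n (A : 'M[C]_n) : A ^t* = A -> (invmx A) ^t* = invmx A.
Proof. by move=> hA; rewrite trmx_inv map_invmx hA. Qed.

Lemma is_mpinvmx_fullrank m r n (K : 'M[C]_(m, r)) (L : 'M[C]_(r, n)) :
  row_full K -> row_free L -> exists X, is_mpinvmx (K *m L) X.
Proof.
move=> Kf Lf; set A := K *m L.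
have uL : L *m L ^t* \in unitmx by apply: row_free_gram_unit.
have uK : K ^t* *m K \in unitmx.
  rewrite -{2}[K]trmxCK; apply: row_free_gram_unit.
  by rewrite /row_free mxrank_map mxrank_tr.
have hL : (L *m L ^t*) ^t* = L *m L ^t* by rewrite adjmxM trmxCK.
have hK : (K ^t* *m K) ^t* = K ^t* *m K by rewrite adjmxM trmxCK.
pose GL := invmx (L *m L ^t*); pose GK := invmx (K ^t* *m K).
have eL : L *m (L ^t* *m GL) = 1%:M by rewrite mulmxA mulmxV.
have eK : (GK *m K ^t*) *m K = 1%:M by rewrite -mulmxA mulVmx.
pose X := (L ^t* *m GL) *m (GK *m K ^t*).
have eAX : A *m X = K *m (GK *m K ^t*).
  by rewrite /A /X mulmxA -(mulmxA K L) eL mulmx1.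
have eXA : X *m A = (L ^t* *m GL) *m L.
  by rewrite /A /X mulmxA -(mulmxA _ _ K) eK mulmx1.
exists X; split.
- by rewrite eAX /A mulmxA -(mulmxA K _ K) eK mulmx1.
- by rewrite eXA /X mulmxA -(mulmxA _ L) eL mulmx1.
- by rewrite eAX !adjmxM trmxCK (adjmx_inv hK) mulmxA.
- by rewrite eXA !adjmxM trmxCK (adjmx_inv hL) mulmxA.
Qed.

Lemma is_mpinvmx_exists m n (A : 'M[C]_(m, n)) : exists X, is_mpinvmx A X.
Proof.
have [X] := is_mpinvmx_fullrank (col_base_full A) (row_base_free A).
by rewrite mulmx_base; exists X.
Qed.

Lemma mpinvmx_spec m n (A : 'M[C]_(m, n)) : is_mpinvmx A (mpinvmx A).
Proof. by have [X AX] := is_mpinvmx_exists A; apply: (xgetPex 0); exists X. Qed.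

Lemma mpinvmx_unique m n (A : 'M[C]_(m, n)) X : is_mpinvmx A X -> X = mpinvmx A.
Proof.
have [] := mpinvmx_spec A; set Y := mpinvmx A => Y1 Y2 Y3 Y4 [X1 X2 X3 X4].
have eAX : A *m X = A *m Y.
  have e : A *m X = (A *m Y) *m (A *m X) by rewrite mulmxA Y1.
  by rewrite -X3 e adjmxM X3 Y3 mulmxA X1.
have eXA : X *m A = Y *m A.
  have e : X *m A = (X *m A) *m (Y *m A) by rewrite -mulmxA (mulmxA A) Y1.
  by rewrite -X4 e adjmxM X4 Y4 -mulmxA (mulmxA A) X1.
by rewrite -X2 eXA -mulmxA eAX mulmxA Y2.
Qed.

End WellDefined.

(* Main.v *)
(** Expanding the square, [||P - Q||^2 = tr (Q^* Q) - tr (P H)] for every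
    projection [P], where [H = Q + Q^* - 1].  So the nearest projection is the
    one maximising [tr (P H)], namely the spectral projection of [H] for its
    positive eigenvalues.  Put [T = |Q^*|] and [V = T + Q], so that
    [m(Q) = V^* T^dag (T + 1)^-1 V / 2].  From [V V^* = 2 T (T + 1)] and
    [H V^* = V^* T] one gets that [M = m(Q)] is a projection with
    [H M = V^* (T + 1)^-1 V / 2 >= 0], and [V (1 - M) = 0] gives
    [H (1 - M) = - (1 - M) (2 T + 1) (1 - M) <= 0]. *)
Require Import Defs.
From mathcomp Require Import all_boot all_order all_algebra.
From mathcomp Require Import complex ring reals.

Import Order.TTheory GRing.Theory Num.Theory.

Local Open Scope ring_scope.
Local Open Scope sesquilinear_scope.

Section NearestProjection.
Set Implicit Arguments.
Unset Strict Implicit.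
Variables (C : numClosedFieldType) (n : nat).
Implicit Types A B H M P Q T : 'M[C]_n.

Lemma projectionmxC P : projectionmx P -> projectionmx (1%:M - P).
Proof.
move=> [hP PP]; split; first by rewrite adjmxB adjmx1 hP.
by rewrite mulmxBl mul1mx mulmxBr mulmx1 PP subrr subr0.
Qed.

Lemma psdmxD A B : psdmx A -> psdmx B -> psdmx (A + B).
Proof.
move=> [hA pA] [hB pB]; split=> [|v]; first by rewrite adjmxD hA hB.
by rewrite mulmxDr mulmxDl mxE addr_ge0.
Qed.

Lemma psdmxZ (c : C) A : 0 <= c -> psdmx A -> psdmx (c *: A).
Proof.
move=> c0 [hA pA]; split=> [|v].
  by rewrite linearZ map_mxZ hA; congr (_ *: _); apply/CrealP/ger0_real.
by rewrite -scalemxAr -scalemxAl mxE mulr_ge0.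
Qed.

Lemma psdmx1 : psdmx (1%:M : 'M[C]_n).
Proof.
split=> [|v]; first exact: adjmx1.
by rewrite mulmx1 adjmx_mul_diag_ge0.
Qed.

Lemma psdmx_inv A : A \in unitmx -> psdmx A -> psdmx (invmx A).
Proof.
move=> uA pA; have hA := proj1 pA.
suff -> : invmx A = invmx A *m A *m (invmx A) ^t* by apply: psdmx_conj.
by rewrite mulVmx // mul1mx adjmx_inv.
Qed.

Lemma mxtrace_projection_psd_ge0 P A :
  projectionmx P -> psdmx A -> 0 <= \tr (P *m A).
Proof.
move=> [hP PP] pA.
have -> : \tr (P *m A) = \tr (P *m A *m P ^t*).
  by rewrite hP [RHS]mxtrace_mulC mulmxA PP.
by apply: sumr_ge0 => i _; apply: psdmx_conj_ge0.
Qed.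

(** The gap between the two traces splits as [tr ((1 - P) (H M)) + tr (P (H M - H))], and each term
    pairs a projection with a positive semi-definite matrix. *)
Lemma mxtrace_projection_le H M P : projectionmx P ->
  psdmx (H *m M) -> psdmx (H *m M - H) -> \tr (P *m H) <= \tr (M *m H).
Proof.
move=> pP pX pY; rewrite (mxtrace_mulC M) -subr_ge0.
have -> : \tr (H *m M) - \tr (P *m H)
    = \tr ((1%:M - P) *m (H *m M)) + \tr (P *m (H *m M - H)).
  by rewrite mulmxBl mul1mx mulmxBr !linearB /= addrA subrK.
by rewrite addr_ge0 ?mxtrace_projection_psd_ge0 //; apply: projectionmxC.
Qed.

Lemma mxtrace_gram_projectionB P Q : projectionmx P ->
  \tr ((P - Q) ^t* *m (P - Q))
    = \tr (Q ^t* *m Q) - \tr (P *m (Q + Q ^t* - 1%:M)).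
Proof.
move=> [hP PP]; rewrite adjmxB hP !(mulmxBl, mulmxBr, mulmxDr) mulmx1 PP.
rewrite !linearB linearD /= (mxtrace_mulC (Q ^t*) P).
by ring.
Qed.

(** Taking adjoints swaps the two symmetry conditions of Penrose and preserves the other two, so
    uniqueness of the inverse applies. *)
Lemma mpinvmx_hermitian A : A ^t* = A -> (mpinvmx A) ^t* = mpinvmx A.
Proof.
move=> hA; apply: mpinvmx_unique; have [e1 e2 e3 e4] := mpinvmx_spec A.
split.
- by rewrite -{1 3}hA -!adjmxM mulmxA e1.
- by rewrite -{2}hA -!adjmxM mulmxA e2.
- by rewrite -{1 3}hA -!adjmxM trmxCK e4.
- by rewrite -{2 4}hA -!adjmxM trmxCK e3.
Qed.

Section MatchedProjection.
Variable Q : 'M[C]_n.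
Hypothesis hQ : idempotentmx Q.

Let T := absmx (Q ^t*).
Let G := mpinvmx T.
Let W := invmx (T + 1%:M).
Let V := T + Q.
Let H := Q + Q ^t* - 1%:M.
Let M := matched_projection Q.

(** * Algebraic relations between [Q], [T], [G], [W], [V] and [H] *)

Let psdT : psdmx T. Proof. exact: (proj1 (absmx_spec _)). Qed.

Let hT : T ^t* = T. Proof. exact: (proj1 psdT). Qed.

Let TT : T *m T = Q *m Q ^t*.
Proof. by rewrite (proj2 (absmx_spec _)) trmxCK. Qed.

Let uT1 : T + 1%:M \in unitmx. Proof. exact: absmxD1_unit. Qed.

Let hG : G ^t* = G. Proof. exact: mpinvmx_hermitian. Qed.

Let TGC : T *m G = G *m T.
Proof. by have [_ _ <- _] := mpinvmx_spec T; rewrite adjmxM hT hG. Qed.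

Let psdW : psdmx W.
Proof. by apply: psdmx_inv => //; apply: psdmxD => //; apply: psdmx1. Qed.

Let WC A : A *m T = T *m A -> A *m W = W *m A.
Proof.
move=> AT; apply: (can_inj (mulKmx uT1)); rewrite mulKVmx //.
by rewrite mulmxA mulmxDl mul1mx -AT -[X in _ + X]mulmx1 -mulmxDr mulmxK.
Qed.

(** From [T T = Q Q^*], [T] and [Q] have the same range, on which [Q] is the identity. Concretely,
    [D T = 0] forces [D D^* = 0]. *)
Let QT : Q *m T = T.
Proof.
apply/eqP; rewrite -subr_eq0; apply/eqP.
set D := Q *m T - T; have DT : D *m T = 0.
  by rewrite mulmxBl -mulmxA TT mulmxA hQ subrr.
rewrite -[D]trmxCK; suff -> : D ^t* = 0 by rewrite trmx0 map_mx0.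
apply: adjmx_mul_eq0; rewrite trmxCK {2}/D adjmxB adjmxM hT.
by rewrite mulmxBr mulmxA DT mul0mx subrr.
Qed.

Let TQa : T *m Q ^t* = T.
Proof. by rewrite -[X in X *m _]hT -adjmxM QT. Qed.

(** [T G] is the orthogonal projection onto the range of [T], which is also the range of [Q]. *)
Let TGQ : T *m G *m Q = Q.
Proof.
apply/eqP; rewrite -subr_eq0; apply/eqP.
set D := _ - Q; have eD : D = (T *m G - 1%:M) *m Q by rewrite mulmxBl mul1mx.
rewrite -[D]trmxCK; suff -> : D ^t* = 0 by rewrite trmx0 map_mx0.
apply: adjmx_mul_eq0; rewrite trmxCK eD adjmxM mulmxA -(mulmxA _ Q) -TT.
have [e _ _ _] := mpinvmx_spec T.
by rewrite [_ *m (T *m T)]mulmxA mulmxBl mul1mx e subrr !mul0mx.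
Qed.

Let TGV : T *m G *m V = V.
Proof. by have [e _ _ _] := mpinvmx_spec T; rewrite mulmxDr e TGQ. Qed.

Let Va : V ^t* = T + Q ^t*. Proof. by rewrite adjmxD hT. Qed.

Let VVa : V *m V ^t* = 2 *: (T *m (T + 1%:M)).
Proof.
rewrite Va mulmxDr mulmxDl !mulmxDl QT TQa -TT mulmxDr mulmx1.
by rewrite [T + T *m T]addrC scaler_nat mulr2n.
Qed.

Let HVa : H *m V ^t* = V ^t* *m T.
Proof.
have hQa : Q ^t* *m Q ^t* = Q ^t* by rewrite -adjmxM hQ.
rewrite Va mulmxBl !mulmxDl mul1mx !mulmxDr QT -TT hQa.
by rewrite [T + T *m T]addrC addrACA addrK.
Qed.

Let GWC : G *m W = W *m G. Proof. by rewrite WC. Qed.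

Let eM : M = 2^-1 *: (V ^t* *m G *m W *m V).
Proof. by rewrite Va. Qed.

Let two_neq0 : (2 : C) != 0. Proof. by rewrite pnatr_eq0. Qed.

(** By [VVa] the left side is [T (T + 1) G W V]. As [G] commutes with [T], the factor [T + 1]
    cancels against [W], leaving [T G V]. *)
Let VM : V *m M = V.
Proof.
rewrite eM -scalemxAr !mulmxA VVa -!scalemxAl scalerA mulVf // scale1r.
rewrite -(mulmxA T) mulmxDl mul1mx TGC -{2}[G]mulmx1 -mulmxDr mulmxA.
by rewrite mulmxK.
Qed.

Lemma matched_projectionP : projectionmx M.
Proof.
(* The formula for [M] ends in [V], so [VM] absorbs the second factor of [M *m M]. *)
split; last by rewrite {1}eM -scalemxAl -mulmxA VM -eM.
rewrite eM linearZ map_mxZ /= !adjmxM trmxCK hG (proj1 psdW) -!mulmxA.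
rewrite [W *m (G *m V)]mulmxA -GWC -mulmxA; congr (_ *: _).
by apply/CrealP/ger0_real; rewrite invr_ge0 ler0n.
Qed.

(** The factor [T] produced by [HVa] moves past [G] and [W], and [V] then absorbs [T G]. *)
Let HM : H *m M = 2^-1 *: (V ^t* *m W *m V).
Proof.
rewrite eM -scalemxAr !mulmxA HVa -(mulmxA _ T) -(mulmxA _ (T *m G)) WC.
  by rewrite !mulmxA -(mulmxA _ W T) -!mulmxA [T *m _]mulmxA TGV !mulmxA.
by rewrite -mulmxA -TGC.
Qed.

Lemma psdmx_mul_matched_projection : psdmx (H *m M).
Proof.
rewrite HM; apply: psdmxZ; first by rewrite invr_ge0 ler0n.
by rewrite -{2}[V]trmxCK; apply: psdmx_conj.
Qed.

Lemma psdmx_mul_matched_projectionB : psdmx (H *m M - H).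
Proof.
have [hM _] := matched_projectionP.
have [hN NN] := projectionmxC matched_projectionP.
have hH : H ^t* = H by rewrite adjmxB adjmxD adjmx1 trmxCK [_ + Q]addrC.
(* [H M] is Hermitian, being positive semi-definite, so its Hermitian factors commute. *)
have HMC : H *m M = M *m H.
  by rewrite -(proj1 psdmx_mul_matched_projection) adjmxM hH hM.
have VN : V *m (1%:M - M) = 0 by rewrite mulmxBr mulmx1 VM subrr.
have HNC : H *m (1%:M - M) = (1%:M - M) *m H.
  by rewrite [LHS]mulmxBr [RHS]mulmxBl mulmx1 mul1mx HMC.
have -> : H *m M - H = - (H *m (1%:M - M)).
  by rewrite [H *m (1%:M - M)]mulmxBr mulmx1 [RHS]opprB.
move: (1%:M - M) hN NN VN HNC => N hN NN VN HNC.
have QN : Q *m N = - (T *m N).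
  by apply/eqP; rewrite -addr_eq0 -mulmxDl [Q + T]addrC VN.
have NQ : N *m Q ^t* = - (N *m T).
  by rewrite -{1}hN -adjmxM QN linearN map_mxN /= adjmxM hN hT.
(* By commutation [H N = N H N]. Inside it, [V N = 0] replaces [Q N] by [- T N] and [N Q^*] by
   [- N T]. *)
have -> : - (H *m N) = N *m (T + T + 1%:M) *m N ^t*.
  rewrite -{1}NN mulmxA HNC hN mulmxBr !mulmxDr NQ mulmx1 mulmxBl !mulmxDl.
  by rewrite -(mulmxA N Q) QN mulmxN mulmxA mulNmx !opprD !opprK.
by apply: psdmx_conj; apply: psdmxD psdmx1; apply: psdmxD.
Qed.

End MatchedProjection.

Lemma mxtrace_gram_matched_projection_le Q P :
  idempotentmx Q -> projectionmx P ->
  \tr ((matched_projection Q - Q) ^t* *m (matched_projection Q - Q))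
    <= \tr ((P - Q) ^t* *m (P - Q)).
Proof.
move=> hQ hP; rewrite !mxtrace_gram_projectionB //; last exact: matched_projectionP.
rewrite lerD2l lerN2; apply: mxtrace_projection_le => //.
  exact: psdmx_mul_matched_projection.
exact: psdmx_mul_matched_projectionB.
Qed.

End NearestProjection.

Lemma frobenius_norm_le (R : rcfType) m n (A B : 'M[R[i]]_(m, n)) :
  \tr (A ^t* *m A) <= \tr (B ^t* *m B) -> frobenius_norm A <= frobenius_norm B.
Proof.
(* Writing the trace as the image of a real number brings the inequality down to [R], where the
   square root is monotone. *)
have trE (D : 'M[R[i]]_(m, n)) : \tr (D ^t* *m D)
    = (\sum_(i < m) \sum_(j < n) ComplexField.Normc.normc (D i j) ^+ 2)%:C%C.
  rewrite /mxtrace exchange_big rmorph_sum; apply: eq_bigr => j _.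
  rewrite adjmx_mul_diag rmorph_sum; apply: eq_bigr => i _.
  by rewrite rmorphXn.
by rewrite !trE lecR => ?; apply: ler_wsqrtr.
Qed.

Theorem theorem3p2 (R : realType) (n : nat) (hn : (0 < n)%N)
    (Q P : 'M[R[i]]_n) (hQ : idempotentmx Q) (hP : projectionmx P) :
  frobenius_norm (matched_projection Q - Q) <= frobenius_norm (P - Q).
Proof.
by apply: frobenius_norm_le; apply: mxtrace_gram_matched_projection_le.
Qed.
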